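(* Let $(M,F)$ be a Finsler surface of revolution with coordinates $(u,v)$. Along any unit speed $F$-geodesic $\mathcal{P}(s)=(u(s),v(s))$ the quantity $$p_2(s)=g_{12}(\mathcal{P}(s),\dot{\mathcal{P}}(s))\cdot\frac{du}{ds}+g_{22}(\mathcal{P}(s),\dot{\mathcal{P}}(s))\cdot\frac{dv}{ds}=\nu_F$$ is constant in $s$.
   Context: Let $I\subset\mathbb{R}$ be an open interval and $m:I\to(0,\infty)$ a smooth function. A surface of revolution $M\to\mathbb{R}^3$ is parametrized by $(u,v)\mapsto (m(u)\cos v,\,m(u)\sin v,\,u)$, $u\in I$, $v\in\mathbb{S}^1$. Write $(y^1,y^2)=(\dot u,\dot v)$ for the fiber coordinates on $TM$ induced by $(x^1,x^2)=(u,v)$. A Finsler structure $(M,F)$ on such an $M$ is called a Finsler surface of revolution if $\partial/\partial v$ is a Killing vector field for $F$, i.e. $\frac{\partial F}{\partial v}=0$ in the coordinates $(u,v,\dot u,\dot v)$. The fundamental tensor is $g_{ij}(x,y)=\frac12\frac{\partial^2F^2}{\partial y^i\partial y^j}(x,y)$. A curve is of unit speed if $F(\mathcal{P},\dot{\mathcal{P}})=1$. *)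

(* Defs.v *)
From HB Require Import structures.
From mathcomp Require Import all_boot all_order all_algebra.
From mathcomp Require Import all_classical all_reals all_analysis.

Set Implicit Arguments.
Unset Strict Implicit.
Unset Printing Implicit Defensive.

Import Order.TTheory GRing.Theory Num.Theory.
Import numFieldNormedType.Exports.

Local Open Scope ring_scope.
Local Open Scope classical_set_scope.


Definition open_interval (R : realType) (I : set R) : Prop :=
  open I /\ is_interval I.

(* C^oo on the open set [A]: the derivatives of all orders exist at the points
   of [A]. Each iterated directional derivative is required to be Frechet
   differentiable, hence continuous. *)
Definition smooth_on (R : realType) (V W : normedModType R) (A : set V)
    (f : V -> W) : Prop :=
  forall (dirs : seq V) (x : V), A x ->
    differentiable (foldr (fun v g => 'D_v g) f dirs) x.

Definition vec2 (R : realType) (a b : R) : 'rV[R]_2 :=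
  \row_(i < 2) [:: a; b]`_i.

Definition vec3 (R : realType) (a b c : R) : 'rV[R]_3 :=
  \row_(i < 3) [:: a; b; c]`_i.

(* A point (u, v) of the parameter domain is a row vector; the columns 0 and
   1 carry the coordinates usually numbered 1 and 2. *)
Definition revolution (R : realType) (m : R -> R) (x : 'rV[R]_2) : 'rV[R]_3 :=
  let u := x 0 0 in let v := x 0 1 in vec3 (m u * cos v) (m u * sin v) u.

(* A function on the tangent bundle of the surface, whose elements are pairs
   (point of R^3, tangent vector in R^3), read in the coordinates
   (u, v, du, dv). Only the values of [F] on tangent vectors of the surface are
   used. Here v is an angle, so the result is 2 pi-periodic in v. *)
Definition in_coord (R : realType) (m : R -> R)
    (F : 'rV[R]_3 -> 'rV[R]_3 -> R) (z : 'rV[R]_2 * 'rV[R]_2) : R :=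
  F (revolution m z.1) ('D_(z.2) (revolution m) z.1).

Definition slit_tangent (R : realType) (I : set R) :
    set ('rV[R]_2 * 'rV[R]_2) :=
  [set z : 'rV[R]_2 * 'rV[R]_2 | I (z.1 0 0) /\ z.2 != 0].

Section Coordinates.
Context {R : realType}.
Implicit Types (f : 'rV[R]_2 * 'rV[R]_2 -> R) (z : 'rV[R]_2 * 'rV[R]_2).

Definition dbase (i : 'I_2) f z : R := 'D_(('e_i : 'rV[R]_2), 0) f z.
Definition dfiber (i : 'I_2) f z : R := 'D_(0, ('e_i : 'rV[R]_2)) f z.

Definition sq f z : R := f z ^+ 2.

Definition fundamental_tensor f z : 'M[R]_2 :=
  \matrix_(i < 2, j < 2) (2^-1 * dfiber j (dfiber i (sq f)) z).

(* G^i = 1/4 g^{il} ([F^2]_{x^k y^l} y^k - [F^2]_{x^l}). *)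
Definition spray_coeff f z (i : 'I_2) : R :=
  4^-1 * \sum_(l < 2) invmx (fundamental_tensor f z) i l *
    (\sum_(k < 2) dbase k (dfiber l (sq f)) z * z.2 0 k - dbase l (sq f) z).

End Coordinates.

Record finsler_structure (R : realType) (I : set R) (m : R -> R)
    (F : 'rV[R]_3 -> 'rV[R]_3 -> R) : Prop := FinslerStructure {
  finsler_ge0 : forall x y : 'rV[R]_2,
    I (x 0 0) -> 0 <= in_coord m F (x, y) ;
  finsler_smooth : smooth_on (slit_tangent I) (in_coord m F) ;
  finsler_homogeneous : forall (x y : 'rV[R]_2) (a : R),
    I (x 0 0) -> 0 < a -> in_coord m F (x, a *: y) = a * in_coord m F (x, y) ;
  finsler_convex : forall z : 'rV[R]_2 * 'rV[R]_2, slit_tangent I z ->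
    forall w : 'rV[R]_2, w != 0 ->
      0 < (w *m fundamental_tensor (in_coord m F) z *m w^T) 0 0
}.

Record finsler_surface_of_revolution (R : realType) (I : set R) (m : R -> R)
    (F : 'rV[R]_3 -> 'rV[R]_3 -> R) : Prop := FinslerSurfaceOfRevolution {
  revolution_interval : open_interval I ;
  revolution_profile_gt0 : forall u, I u -> 0 < m u ;
  revolution_profile_smooth : smooth_on I m ;
  revolution_finsler : finsler_structure I m F ;
  revolution_killing : forall z : 'rV[R]_2 * 'rV[R]_2, slit_tangent I z ->
    dbase 1 (in_coord m F) z = 0
}.

(* The coordinate expression (u(s), v(s)) of a smooth curve, v being any smooth
   choice of the angle, which satisfies the geodesic equations
   x^i'' + 2 G^i(x, x') = 0. *)
Record unit_speed_geodesic (R : realType) (I : set R) (m : R -> R)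
    (F : 'rV[R]_3 -> 'rV[R]_3 -> R) (J : set R) (P : R -> 'rV[R]_2) : Prop :=
  UnitSpeedGeodesic {
  geodesic_interval : open_interval J ;
  geodesic_in : forall s, J s -> I (P s 0 0) ;
  geodesic_smooth : smooth_on J P ;
  geodesic_unit_speed : forall s, J s -> in_coord m F (P s, derive1 P s) = 1 ;
  geodesic_equation : forall s (i : 'I_2), J s ->
    derive1n 2 P s 0 i + 2 * spray_coeff (in_coord m F) (P s, derive1 P s) i = 0
}.

(* Main.v *)
Require Import Defs.
From HB Require Import structures.
From mathcomp Require Import all_boot all_order all_algebra.
From mathcomp Require Import all_classical all_reals all_analysis.
From mathcomp Require Import ring lra.
Import Order.TTheory GRing.Theory Num.Theory.
Import numFieldNormedType.Exports.

Set Implicit Arguments.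
Unset Strict Implicit.
Unset Printing Implicit Defensive.

Local Open Scope ring_scope.
Local Open Scope classical_set_scope.

(** Write [L = F ^ 2] in the coordinates [(u, v, du, dv)], as a function on the
    slit tangent bundle. The quantity to be studied is half of the momentum
    [dL / d(dv)] along the velocity curve of the geodesic. Indeed [L] is
    homogeneous of degree 2 in the velocity, so that its fibre derivatives are
    homogeneous of degree 1 and are recovered from the second fibre
    derivatives, i.e. from the fundamental tensor, by Euler's relation
    ([sum_fundamental_tensor_velocity]).

    The geodesic equations, written with the spray coefficients, are the
    Euler-Lagrange equations of [L] solved for the acceleration, which is
    possible because strong convexity makes the fundamental tensor invertible.
    Lowering the index of the spray ([sum_fundamental_tensor_spray]) recovers
    them: the derivative of each momentum is the corresponding position
    derivative of [L] ([euler_lagrange]). As the rotation field is Killing, [L]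
    does not depend on the angle [v]; hence the derivative of the angular
    momentum vanishes, and on the interval of definition of the geodesic the
    momentum is constant. This is Clairaut's relation, an instance of
    Noether's theorem. *)

(** * Calculus and linear algebra *)

(** Iterated derivatives of [sq f] are computed from those of [f] by the
    product rule, which is valid only near a point of the slit tangent bundle;
    this lemma transports differentiability along such a local identity. *)
Lemma near_eq_differentiable (R : numFieldType) (V W : normedModType R)
    (f g : V -> W) (x : V) :
  {near x, f =1 g} -> differentiable g x -> differentiable f x.
Proof.
move=> fg dg.
have [cg /eqaddoP eg] := (diff_locallyP x g).1 dg.
have fgx : f x = g x by exact: nbhs_singleton fg.
have ef : f \o shift x = cst (f x) + 'd g x +o_ (0 : V) id.
  apply/eqaddoP => e e0.
  have h0 : \forall h \near (0 : V), f (h + x) = g (h + x).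
    by move: fg; rewrite (near_shift 0)/= subr0.
  apply: filterS2 h0 (eg e e0) => h /= fgh.
  by rewrite -[(f \o _ - _) h]/(f (h + x) - (f x + 'd g x h)) fgh fgx.
by apply/diff_locallyP; rewrite (diff_unique cg ef).
Qed.

(** Euler's relation for a function homogeneous in its second argument: the
    derivative in the direction of that argument is the derivative at [a = 1]
    of the scaling law. *)
Lemma derive_homogeneous (R : realFieldType) (V W : normedModType R)
    (g : V * W -> R) (x : V) (y : W) (n : nat) :
  differentiable g (x, y) ->
  (forall a, 0 < a -> g (x, a *: y) = a ^+ n * g (x, y)) ->
  'D_(0, y) g (x, y) = n%:R * g (x, y).
Proof.
move=> dg hg.
pose c (a : R) : V * W := (x, a *: y).
have dc : is_diff (1 : R) c (fun a => (0, a *: y)).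
  exact: (@is_diff_pair _ _ _ _ (cst x) (cst 0) _ _ _).
rewrite deriveE//.
have e : 'D_1 (g \o c) 1 = 'd g (x, y) (0, y).
  rewrite deriveE; last by apply: differentiable_comp; rewrite /c ?scale1r.
  rewrite diff_comp//=; last by rewrite /c scale1r.
  by rewrite diff_val /c /= !scale1r.
rewrite -e.
(* The scaling law holds for positive [a], hence near 1. *)
rewrite (@near_eq_derive _ _ _ _ (fun a : R => a ^+ n * g (x, y))) ?oner_eq0//.
  rewrite deriveMr; last exact: exprn_derivable.
  by rewrite exp_derive expr1n /GRing.scale/= !mulr1 mulrC.
near=> a; apply: hg.
near: a; exact: lt_nbhsr.
Unshelve. all: by end_near. Qed.

Lemma derive_row_sum (R : realType) (L : 'rV[R]_2 * 'rV[R]_2 -> R)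
    (z w : 'rV[R]_2 * 'rV[R]_2) : differentiable L z ->
  'D_w L z = \sum_(k < 2) (dbase k L z * w.1 0 k + dfiber k L z * w.2 0 k).
Proof.
move=> dL; rewrite /dbase /dfiber deriveE//.
under eq_bigr do rewrite !deriveE//.
have {1}-> : w = \sum_(k < 2) (w.1 0 k *: ('e_k, 0) + w.2 0 k *: (0, 'e_k)).
  case: w => a b; rewrite big_split/=; apply: injective_projections => /=.
    rewrite !raddf_sum/=.
    by rewrite [a in LHS]row_sum_delta [X in _ + X]big1 ?addr0// => i _;
      rewrite scaler0.
  rewrite !raddf_sum/=.
  by rewrite [b in LHS]row_sum_delta [X in X + _]big1 ?add0r// => i _;
    rewrite scaler0.
rewrite linear_sum; apply: eq_bigr => k _.
by rewrite linearD !linearZ/= ![_ *: 'd _ _ _]mulrC.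
Qed.

Lemma derive_0_is_cst_on (R : realType) (J : set R) (f : R -> R) :
  is_interval J -> (forall s, J s -> is_derive s 1 f 0) ->
  forall s t, J s -> J t -> f s = f t.
Proof.
move=> iJ df.
suff H s t : s <= t -> J s -> J t -> f s = f t.
  move=> s t Js Jt; have [/H->//|/ltW/H->//] := leP s t.
move=> st Js Jt.
have Jst r : r \in `[s, t]%R -> J r.
  by rewrite in_itv => /andP[? ?]; apply: (iJ s t) => //; apply/andP.
have [||c _] := @MVT_segment _ f (fun=> 0) s t st.
- by move=> x /subset_itv_oo_cc/Jst/df.
- apply: derivable_within_continuous => x /Jst/df dx.
  exact: ex_derive.
by rewrite mul0r => /subr0_eq.
Qed.

Lemma is_derive_fiber_coord (R : realType) (z w : 'rV[R]_2 * 'rV[R]_2)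
    (k : 'I_2) :
  is_derive z w (fun z' : 'rV[R]_2 * 'rV[R]_2 => z'.2 0 k) (w.2 0 k).
Proof.
have H : (fun h : R => h^-1 *: (((h *: w + z).2 0 k : R) - z.2 0 k)) @ 0^'
    --> w.2 0 k.
  apply: cvg_near_cst; near=> h.
  rewrite /= !mxE addrK /GRing.scale/= mulKf//.
  by near: h; exact: nbhs_dnbhs_neq.
apply: DeriveDef; last exact: cvg_lim H.
by apply/cvg_ex; exists (w.2 0 k).
Unshelve. all: by end_near. Qed.

(** A row vector in the kernel would make the quadratic form vanish. *)
Lemma posdef_unitmx (R : realFieldType) (n : nat) (M : 'M[R]_n) :
  (forall w : 'rV_n, w != 0 -> 0 < (w *m M *m w^T) 0 0) -> M \in unitmx.
Proof.
move=> posM; rewrite -row_free_unit; apply: inj_row_free => w wM0.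
apply/eqP/negPn/negP => /posM.
by rewrite wM0 mul0mx mxE ltxx.
Qed.

(** * Regularity on the slit tangent bundle *)

Lemma open_slit_tangent (R : realType) (I : set R) :
  open I -> open (slit_tangent I).
Proof.
move=> oI.
pose pu (z : 'rV[R]_2 * 'rV[R]_2) : R := z.1 0 0.
pose ny (z : 'rV[R]_2 * 'rV[R]_2) : R := `|z.2|.
have -> : slit_tangent I = pu @^-1` I `&` ny @^-1` [set r | 0 < r].
  by apply/seteqP; split=> z [Iz z0]; split=> //;
    move: z0; rewrite /ny/= normr_gt0.
apply: openI; apply: open_comp => //.
- move=> z _; apply: (@continuous_comp _ _ _ fst (fun x : 'rV[R]_2 => x 0 0)).
    exact: cvg_fst.
  exact: coord_continuous.
- move=> z _; apply: (@continuous_comp _ _ _ snd (fun y : 'rV[R]_2 => `|y|)).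
    exact: cvg_snd.
  exact: norm_continuous.
Qed.

Lemma differentiable_sq (R : realType) (f : 'rV[R]_2 * 'rV[R]_2 -> R) z :
  differentiable f z -> differentiable (sq f) z.
Proof. by move=> df; rewrite -[sq f]/(f ^+ 2); exact: differentiableX. Qed.

Lemma derive_sq (R : realType) (f : 'rV[R]_2 * 'rV[R]_2 -> R) z w :
  differentiable f z -> 'D_w (sq f) z = 2 * f z * 'D_w f z.
Proof.
move=> df; rewrite -[sq f]/(f ^+ 2) deriveX; last exact: diff_derivable.
by rewrite /GRing.scale/= expr1.
Qed.

Lemma differentiable_derive_sq (R : realType)
    (A : set ('rV[R]_2 * 'rV[R]_2)) (f : 'rV[R]_2 * 'rV[R]_2 -> R) z w :
  open A -> smooth_on A f -> A z -> differentiable ('D_w (sq f)) z.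
Proof.
move=> oA sf Az.
apply: (@near_eq_differentiable _ _ _ _ ((2 *: f) * 'D_w f)).
  apply: filterS (open_nbhs_nbhs (conj oA Az)) => x Ax.
  rewrite derive_sq//; exact: (@sf [::] x Ax).
apply: differentiableM; last exact: (@sf [:: w] z Az).
apply: differentiableZ; exact: (@sf [::] z Az).
Qed.

(** * Momenta and the Euler-Lagrange equations *)

(** Euler's relation says that the sum of the fibre derivatives of [sq f],
    each multiplied by the matching velocity component, is [2 * sq f]. Taking
    the derivative in the fibre direction [l], the velocity component [l]
    contributes one copy of [dfiber l (sq f)] on the left, against two copies
    on the right. The sum runs over the first index of the tensor, whose
    derivative is the inner one, so that the symmetry of second derivatives
    does not enter. *)
Lemma sum_fundamental_tensor_velocity (R : realType) (I : set R)
    (f : 'rV[R]_2 * 'rV[R]_2 -> R) (z : 'rV[R]_2 * 'rV[R]_2) (l : 'I_2) :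
  open I -> smooth_on (slit_tangent I) f ->
  (forall (x y : 'rV[R]_2) (a : R), I (x 0 0) -> 0 < a ->
    f (x, a *: y) = a * f (x, y)) ->
  slit_tangent I z ->
  \sum_(k < 2) fundamental_tensor f z k l * z.2 0 k
    = 2^-1 * dfiber l (sq f) z.
Proof.
move=> oI sf hf Az.
have oA := open_slit_tangent oI.
have dL x : slit_tangent I x -> differentiable (sq f) x.
  by move=> Ax; apply: differentiable_sq; exact: (@sf [::] x Ax).
have ddL k x : slit_tangent I x -> differentiable (dfiber k (sq f)) x.
  exact: differentiable_derive_sq.
pose E k := dfiber k (sq f) * (fun x : 'rV[R]_2 * 'rV[R]_2 => x.2 0 k).
have euler : \forall x \near z, (\sum_(k < 2) E k) x = (2 *: sq f) x.
  apply: filterS (open_nbhs_nbhs (conj oA Az)) => -[x y] Ax.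
  have -> : (2 *: sq f) (x, y) = 'D_(0, y) (sq f) (x, y).
    rewrite (@derive_homogeneous _ _ _ _ _ _ 2)//; first exact: dL.
    by move=> a a0; rewrite /sq hf ?exprMn//; case: Ax.
  rewrite derive_row_sum; last exact: dL.
  rewrite fct_sumE; apply: eq_bigr => k _ /=.
  by rewrite mxE mulr0 add0r.
have dE k : is_derive z (0, 'e_l) (E k)
    (dfiber k (sq f) z * (l == k)%:R
      + z.2 0 k * dfiber l (dfiber k (sq f)) z).
  have d1 : is_derive z (0, 'e_l) (dfiber k (sq f))
      (dfiber l (dfiber k (sq f)) z).
    by apply: DeriveDef => //; apply: diff_derivable; exact: ddL.
  have d2 := is_derive_fiber_coord z (0, 'e_l) k.
  apply: is_derive_eq; rewrite /GRing.scale/=; congr (_ * _ + _).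
  by rewrite mxE eqxx eq_sym.
have dEs := is_derive_sum dE.
have := near_eq_derive (0, 'e_l) euler.
rewrite (@derive_val _ _ _ _ _ _ _ dEs) deriveZ; last first.
  by apply: diff_derivable; exact: dL.
rewrite -[X in _ *: X]/(dfiber l (sq f) z) big_split/=.
rewrite [X in X + _](bigD1 l)//= eqxx mulr1 [X in _ + X + _]big1; last first.
  by move=> k /negPf; rewrite eq_sym => ->; rewrite mulr0.
rewrite /GRing.scale/= => eul.
have {}eul : \sum_(k < 2) z.2 0 k * dfiber l (dfiber k (sq f)) z
    = dfiber l (sq f) z by lra.
by rewrite -eul mulr_sumr; apply: eq_bigr => k _; rewrite mxE mulrCA mulrC.
Qed.

(** The spray coefficients are the inverse tensor applied to the bracket on the
    right; lowering their index by the tensor undoes that inversion. *)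
Lemma sum_fundamental_tensor_spray (R : realType)
    (f : 'rV[R]_2 * 'rV[R]_2 -> R) (z : 'rV[R]_2 * 'rV[R]_2) (l : 'I_2) :
  fundamental_tensor f z \in unitmx ->
  \sum_(i < 2) fundamental_tensor f z l i * spray_coeff f z i
    = 4^-1 * (\sum_(k < 2) dbase k (dfiber l (sq f)) z * z.2 0 k
               - dbase l (sq f) z).
Proof.
set g := fundamental_tensor f z => gU.
pose b : 'cV[R]_2 := \col_i
  (\sum_(k < 2) dbase k (dfiber i (sq f)) z * z.2 0 k - dbase i (sq f) z).
have sprayE i : spray_coeff f z i = (4^-1 *: (invmx g *m b)) i 0.
  by rewrite !mxE; congr (_ * _); apply: eq_bigr => j _; rewrite !mxE.
transitivity ((g *m (4^-1 *: (invmx g *m b))) l 0).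
  by rewrite mxE; apply: eq_bigr => i _; rewrite sprayE.
by rewrite -scalemxAr mulKVmx// !mxE.
Qed.

(** The chain rule along the velocity curve produces position terms and
    acceleration terms of the momentum. The geodesic equation replaces the
    acceleration by the spray, whose contraction with the tensor is a multiple
    of the Euler-Lagrange bracket: the position terms cancel, and only the
    position derivative of the Lagrangian survives. *)
Lemma euler_lagrange (R : realType) (I : set R)
    (f : 'rV[R]_2 * 'rV[R]_2 -> R) (P : R -> 'rV[R]_2) (s : R) (l : 'I_2) :
  open I -> smooth_on (slit_tangent I) f ->
  differentiable P s -> differentiable (derive1 P) s ->
  slit_tangent I (P s, derive1 P s) ->
  fundamental_tensor f (P s, derive1 P s) \in unitmx ->
  (forall i, derive1n 2 P s 0 i + 2 * spray_coeff f (P s, derive1 P s) i = 0) ->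
  is_derive s 1 (fun t => dfiber l (sq f) (P t, derive1 P t))
    (dbase l (sq f) (P s, derive1 P s)).
Proof.
move=> oI sf dP dP' Az gU geo.
pose c t := (P t, derive1 P t).
have dc : differentiable c s by exact: differentiable_pair.
have dh : differentiable (dfiber l (sq f)) (c s).
  exact: differentiable_derive_sq (open_slit_tangent oI) sf Az.
apply: DeriveDef.
  by apply: diff_derivable; exact: (differentiable_comp dc dh).
rewrite -[LHS]/('D_1 (dfiber l (sq f) \o c) s).
rewrite deriveE; last exact: differentiable_comp.
have c' : 'd c s 1 = (derive1 P s, derive1 (derive1 P) s).
  by rewrite diff_pair// !derive1E'.
rewrite diff_comp//= c' -deriveE// derive_row_sum// big_split/=.
have -> : \sum_(k < 2) dfiber k (dfiber l (sq f)) (c s)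
            * derive1 (derive1 P) s 0 k
        = - 4 * \sum_(k < 2) fundamental_tensor f (c s) l k
              * spray_coeff f (c s) k.
  rewrite mulr_sumr; apply: eq_bigr => k _; rewrite [X in _ * (X * _)]mxE.
  have /eqP := geo k; rewrite addr_eq0 -derive1n1 -derive1nS => /eqP ->.
  by rewrite -/(c s); field.
rewrite sum_fundamental_tensor_spray//=.
by set S := \sum_(k < 2) _; field.
Qed.

(** * Conservation of the angular momentum *)

Theorem theorem4p4 (R : realType) (I : set R) (m : R -> R)
    (F : 'rV[R]_3 -> 'rV[R]_3 -> R)
    (hF : finsler_surface_of_revolution I m F)
    (J : set R) (u v : R -> R)
    (hP : unit_speed_geodesic I m F J (fun s => vec2 (u s) (v s))) :
  let P := fun s => vec2 (u s) (v s) in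
  let g := fun s => fundamental_tensor (in_coord m F) (P s, derive1 P s) in
  exists nu_F : R, forall s, J s ->
    g s 0 1 * derive1 u s + g s 1 1 * derive1 v s = nu_F.
Proof.
move=> P g.
case: hF => -[oI _] _ _ [_ sf hf posg] kill.
case: hP => -[_ iJ] PI sP unitP geo.
set f := in_coord m F in sf hf posg kill unitP geo g *.
have Az s : J s -> slit_tangent I (P s, derive1 P s).
  move=> Js; split; first exact: PI.
  (* Homogeneity makes [f] vanish on zero vectors, unlike unit speed. *)
  apply/eqP => /= P'0.
  have := hf (P s) 0 2 (PI s Js) (ltr0Sn _ _).
  have := unitP s Js; rewrite -/P P'0 scaler0 => ->; lra.
have dP s : J s -> differentiable P s by exact: (sP [::]).
have dP' s : J s -> differentiable (derive1 P) s.
  move=> Js; have -> : derive1 P = 'D_1 P by apply/funext => t; exact: derive1E.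
  exact: (sP [:: 1]).
pose p s := dfiber 1 (sq f) (P s, derive1 P s).
(* The angle does not occur in the Lagrangian, since
   [dbase 1 (sq f) = 2 f * dbase 1 f]. *)
have p' s : J s -> is_derive s 1 p 0.
  move=> Js.
  have <- : dbase 1 (sq f) (P s, derive1 P s) = 0.
    rewrite /dbase derive_sq; last exact: (@sf [::] _ (Az s Js)).
    by rewrite -[X in _ * X]/(dbase 1 f _) kill ?mulr0//; exact: Az.
  apply: (euler_lagrange 1 oI sf); [exact: dP|exact: dP'|exact: Az| |].
    by apply: posdef_unitmx; apply: posg; exact: Az.
  by move=> i; exact: geo.
have P'E s (i : 'I_2) : J s -> derive1 P s 0 i = derive1 (fun t => P t 0 i) s.
  move=> Js; rewrite [in LHS]derive1E derive_mx ?mxE ?derive1E//.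
  by apply: diff_derivable; exact: dP.
have gE s : J s -> g s 0 1 * derive1 u s + g s 1 1 * derive1 v s = 2^-1 * p s.
  move=> Js.
  have uE : u = fun t => P t 0 0 by apply/funext => t; rewrite mxE.
  have vE : v = fun t => P t 0 1 by apply/funext => t; rewrite mxE.
  have -> : derive1 u s = derive1 P s 0 0 by rewrite P'E// -uE.
  have -> : derive1 v s = derive1 P s 0 1 by rewrite P'E// -vE.
  have := sum_fundamental_tensor_velocity 1 oI sf hf (Az s Js).
  rewrite big_ord_recl big_ord1 => <-.
  by congr (_ + g s _ 1 * derive1 P s 0 _); exact: val_inj.
have [[s0 Js0]|J0] := pselect (exists s, J s).
  exists (2^-1 * p s0) => s Js.
  by rewrite (gE s Js) (derive_0_is_cst_on iJ p' Js Js0).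
by exists 0 => s Js; case: J0; exists s.
Qed.
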